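(* Let $E$ be an order continuous Köthe function space. Let $X$ be a real Banach space and let $Y$ be a constrained subspace of $X$, being the range of a norm-one linear projection $P$ on $X$. Let $Z_1,Z_2$ be closed linear subspaces of $X$ such that $P(Z_1)\subseteq Z_1$ and $Z_2=Z_1\cap Y$. If $E(Z_1)$ is a central subspace of $E(X)$, then $E(Z_2)$ is a central subspace of $E(Y)$.
   Context: All Banach spaces are real; ''subspace'' means closed linear subspace; $B_X(x,r)$ denotes the closed ball in $X$ with center $x$ and radius $r>0$. A subspace $Y$ of $X$ is constrained if it is the range of a norm-one linear projection on $X$. Köthe function space: let $(\Omega,\Sigma,\mu)$ be a $\sigma$-finite measure space. A Köthe function space $E$ (on it) is a Banach space of (classes of a.e. equal) real-valued measurable functions such that (1) $\chi_A\in E$ for every $A\in\Sigma$ of finite measure; (2) if $g\in E$ and $f$ is a measurable function with $|f(\omega)|\le|g(\omega)|$ for almost all $\omega\in\Omega$, then $f\in E$ and $\|f\|_E\le\|g\|_E$. $E$ is order continuous if for every decreasing sequence $(f_n)$ in $E$ converging to $0$ pointwise for almost all $\omega\in\Omega$ one has $\lim_n\|f_n\|=0$. Köthe–Bochner function space: $E(X)$ is the collection of all (strongly) measurable functions $F:\Omega\to X$ (modulo a.e. equality) such that $[\omega\mapsto\|F(\omega)\|_X]\in E$, with norm $\|F\|_{E(X)}=\big\|\,\|F(\cdot)\|_X\,\big\|_E$. Central subspace: a subspace $Y$ of a Banach space $X$ is a central subspace of $X$ if every finite family of closed balls with centers in $Y$ that has nonempty intersection in $X$ also intersects in $Y$;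 i.e. for all $y_1,\dots,y_n\in Y$ and $r_1,\dots,r_n>0$, $\bigcap_{i=1}^n B_X(y_i,r_i)\neq\emptyset$ implies $Y\cap\bigcap_{i=1}^n B_X(y_i,r_i)\neq\emptyset$. *)

(* Defs.v *)
From HB Require Import structures.
From mathcomp Require Import all_boot all_order all_algebra.
From mathcomp Require Import all_classical all_reals all_analysis.

Set Implicit Arguments.
Unset Strict Implicit.
Unset Printing Implicit Defensive.

Import Order.TTheory GRing.Theory Num.Theory.
Import numFieldNormedType.Exports.

Local Open Scope classical_set_scope.
Local Open Scope ring_scope.

(** Spaces of classes of a.e. equal functions are handled through their
    everywhere-defined representatives.  The norm of such a space is then a
    seminorm [N] on representatives, two of which are equal in the space iff
    [N (x - y) = 0]. *)

Definition closed_subspace (R : realType) (X : normedModType R)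
    (Z : set X) : Prop :=
  GRing.submod_closed (mem Z) /\ closed Z.

(** [P] is idempotent and its operator norm, the supremum of [|P x|] over the
    unit ball, is 1. *)
Definition norm_one_projection (R : realType) (X : normedModType R)
    (P : {linear X -> X}) : Prop :=
  (forall x, P (P x) = P x) /\
  ereal_sup [set `|P x|%:E | x in [set x | `|x| <= 1]] = 1%E.

(** [Y] is a closed linear subspace of the seminormed space [V]; closedness is
    up to elements at distance zero (see above). *)
Definition closed_subspace_of (R : realType) (L : lmodType R) (N : L -> R)
    (V Y : set L) : Prop :=
  [/\ Y `<=` V, GRing.submod_closed (mem Y) &
      forall x, V x -> (forall e, 0 < e -> exists2 y, Y y & N (x - y) < e) ->
        exists2 y, Y y & N (x - y) = 0].

Definition central_subspace (R : realType) (L : lmodType R) (N : L -> R)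
    (V Y : set L) : Prop :=
  closed_subspace_of N V Y /\
  forall (n : nat) (y : 'I_n -> L) (r : 'I_n -> R),
    (forall i, Y (y i)) -> (forall i, 0 < r i) ->
    (exists2 x, V x & forall i, N (x - y i) <= r i) ->
    exists2 x, Y x & forall i, N (x - y i) <= r i.

(** [kothe_car] is the set of all measurable representatives of elements of the
    space; the value of [kothe_norm] outside of it is irrelevant.  By
    [kothe_ideal], membership and norm only depend on the a.e. class. *)
Record kothe_space d (T : measurableType d) (R : realType)
    (mu : {sigma_finite_measure set T -> \bar R}) := KotheSpace {
  kothe_car : set (T -> R) ;
  kothe_norm : (T -> R) -> R ;
  kothe_measurable : forall f, kothe_car f -> measurable_fun [set: T] f ;
  kothe_submod : GRing.submod_closed (mem kothe_car) ;
  kothe_normZ : forall (a : R) f, kothe_car f ->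
    kothe_norm (a *: f) = `|a| * kothe_norm f ;
  kothe_normD : forall f g, kothe_car f -> kothe_car g ->
    kothe_norm (f + g) <= kothe_norm f + kothe_norm g ;
  kothe_norm0_eq0 : forall f, kothe_car f -> kothe_norm f = 0 ->
    {ae mu, forall t, f t = 0} ;
  kothe_complete : forall u : nat -> T -> R, (forall n, kothe_car (u n)) ->
    (forall e, 0 < e -> exists M : nat, forall m n : nat,
      (M <= m)%N -> (M <= n)%N -> kothe_norm (u m - u n) < e) ->
    exists2 f, kothe_car f & kothe_norm (u n - f) @[n --> \oo] --> 0 ;
  kothe_indic : forall A : set T, measurable A -> (mu A < +oo)%E ->
    kothe_car \1_A ;
  kothe_ideal : forall f g : T -> R, kothe_car g ->
    measurable_fun [set: T] f -> {ae mu, forall t, `|f t| <= `|g t|} ->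
    kothe_car f /\ kothe_norm f <= kothe_norm g
}.

Definition order_continuous d (T : measurableType d) (R : realType)
    (mu : {sigma_finite_measure set T -> \bar R}) (E : kothe_space mu) : Prop :=
  forall f : nat -> T -> R,
    (forall n, kothe_car E (f n)) ->
    (forall n, {ae mu, forall t, f n.+1 t <= f n t}) ->
    {ae mu, forall t, f n t @[n --> \oo] --> 0} ->
    kothe_norm E (f n) @[n --> \oo] --> 0.

Definition simple_function d (T : measurableType d) (X : Type)
    (s : T -> X) : Prop :=
  finite_set (range s) /\ forall x, measurable (s @^-1` [set x]).

(** Strong measurability of [F] as a function into the subset [Z].  A function
    which is only an a.e. limit of simple functions has a representative which
    is an everywhere limit, so this gives the usual a.e. classes. *)
Definition strongly_measurable_in d (T : measurableType d) (R : realType)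
    (X : normedModType R) (Z : set X) (F : T -> X) : Prop :=
  (forall t, Z (F t)) /\
  exists s : nat -> T -> X,
    (forall n, simple_function (s n) /\ forall t, Z (s n t)) /\
    forall t, s n t @[n --> \oo] --> F t.

(** Representatives of the elements of [E(Z)], for [Z] a subspace of [X]. *)
Definition kothe_bochner d (T : measurableType d) (R : realType)
    (mu : {sigma_finite_measure set T -> \bar R}) (E : kothe_space mu)
    (X : normedModType R) (Z : set X) : set (T -> X) :=
  [set F | strongly_measurable_in Z F /\ kothe_car E (fun t => `|F t|)].

Definition kothe_bochner_norm d (T : measurableType d) (R : realType)
    (mu : {sigma_finite_measure set T -> \bar R}) (E : kothe_space mu)
    (X : normedModType R) (F : T -> X) : R :=
  kothe_norm E (fun t => `|F t|).

(* Main.v *)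
(** Composition with [P] maps [E(Z1)] into [E(Z2)], fixes [E(Y)] pointwise and
    does not increase the norm, so it carries the points and approximants that
    the hypothesis provides in [E(Z1)] to points of [E(Z2)]. *)
Require Import Defs.
From HB Require Import structures.
From mathcomp Require Import all_boot all_order all_algebra.
From mathcomp Require Import all_classical all_reals all_analysis.
From mathcomp Require Import measurable_realfun.
Import Order.TTheory GRing.Theory Num.Theory.
Import numFieldNormedType.Exports.
Local Open Scope classical_set_scope.
Local Open Scope ring_scope.

(** For nonzero [x] the vector [|x|^-1 *: x] lies in the unit ball, so the supremum bounds its image
    by 1; homogeneity does the rest. *)
Lemma norm_one_projection_le (R : realType) (X : normedModType R)
    (P : {linear X -> X}) (hP : norm_one_projection P) (x : X) :
  `|P x| <= `|x|.
Proof.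
have [->|x0] := eqVneq x 0; first by rewrite linear0.
have nx : 0 < `|x| by rewrite normr_gt0.
have [_ hsup] := hP.
have : (`|P (`|x|^-1 *: x)|%:E <= 1)%E.
  rewrite -hsup; apply: ereal_sup_ubound; exists (`|x|^-1 *: x) => //=.
  by rewrite normrZ normfV normr_id mulVf ?gt_eqF.
by rewrite lee_fin linearZ normrZ normfV normr_id mulrC ler_pdivrMr// mul1r.
Qed.

Lemma norm_one_projection_continuous (R : realType) (X : normedModType R)
    (P : {linear X -> X}) : norm_one_projection P -> continuous P.
Proof.
move=> hP x; apply/cvgrPdist_lt => e e0; near=> y.
rewrite -linearB; apply: le_lt_trans (norm_one_projection_le _ _ _ hP _) _.
near: y; apply: cvgr_dist_lt => //; exact: cvg_id.
Unshelve. all: by end_near. Qed.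

(** [B] is arbitrary and [A] carries no sigma-algebra: only finitely many values are taken, so the
    preimage is a finite union of measurable fibres. *)
Lemma simple_function_preimage d (T : measurableType d) (A : Type) (s : T -> A)
    (B : set A) : simple_function s -> measurable (s @^-1` B).
Proof.
move=> [fs ms].
have -> : s @^-1` B = \bigcup_(a in range s `&` B) s @^-1` [set a].
  apply/seteqP; split=> [t Bt|t [a [_ Ba]] /= ->//].
  by exists (s t) => //; split=> //; exists t.
apply: fin_bigcup_measurable => [|a _]; last exact: ms.
exact: finite_setIl.
Qed.

Lemma simple_function_comp d (T : measurableType d) (A B : Type) (f : A -> B)
    (s : T -> A) : simple_function s -> simple_function (f \o s).
Proof.
move=> ss; split=> [|b].
  by rewrite -(image_comp s f); apply: finite_image; case: ss.
exact: (simple_function_preimage _ _ _ _ (f @^-1` [set b]) ss).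
Qed.

(** Pairing followed by composition makes simple functions stable under any binary operation; it is
    applied to subtraction. *)
Lemma simple_function_pair d (T : measurableType d) (A B : Type) (s : T -> A)
    (s' : T -> B) : simple_function s -> simple_function s' ->
  simple_function (fun t => (s t, s' t)).
Proof.
move=> [fs ms] [fs' ms']; split.
  apply: (@sub_finite_set _ _ (range s `*` range s')); last exact: finite_setX.
  by move=> _ [t _ <-]; split; exists t.
move=> [a b].
have -> : (fun t => (s t, s' t)) @^-1` [set (a, b)] =
    s @^-1` [set a] `&` s' @^-1` [set b].
  by apply/seteqP; split=> [t [<- <-]//|t [/= -> ->]].
exact: measurableI.
Qed.

Section strongly_measurable.
Context {d : measure_display} {T : measurableType d} {R : realType}.
Context {X : normedModType R}.
Implicit Types (Z W : set X) (F G : T -> X) (P : {linear X -> X}).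

Lemma strongly_measurable_inS Z W F : Z `<=` W ->
  strongly_measurable_in Z F -> strongly_measurable_in W F.
Proof.
move=> ZW [ZF [s [hs sF]]]; split=> [t|]; first exact/ZW.
by exists s; split=> // n; split=> [|t]; [case: (hs n)|apply/ZW; case: (hs n)].
Qed.

(** The approximants [f \o s n] stay simple and take values in [W]; continuity of [f] carries over
    the pointwise convergence. *)
Lemma strongly_measurable_in_comp Z W F (f : X -> X) : continuous f ->
  f @` Z `<=` W -> strongly_measurable_in Z F ->
  strongly_measurable_in W (f \o F).
Proof.
move=> cf fZW [ZF [s [hs sF]]]; split=> [t|].
  by apply: fZW; exists (F t).
exists (fun n => f \o s n); split=> [n|t]; last exact: (continuous_cvg _ (cf _)).
split=> [|t]; first by apply: simple_function_comp; case: (hs n).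
by apply: fZW; exists (s n t) => //; case: (hs n).
Qed.

Lemma strongly_measurable_inB F G : strongly_measurable_in setT F ->
  strongly_measurable_in setT G -> strongly_measurable_in setT (F - G).
Proof.
move=> [_ [s [hs sF]]] [_ [s' [hs' sG]]]; split=> //.
exists (fun n t => s n t - s' n t); split=> [n|t]; last exact: cvgB.
split=> //; apply: (simple_function_comp _ _ _ _
  (fun p : X * X => p.1 - p.2) (fun t => (s n t, s' n t))).
by apply: simple_function_pair; [case: (hs n)|case: (hs' n)].
Qed.

(** The norm of [F] is a pointwise limit of norms of simple functions. This supplies the
    measurability that [kothe_ideal] asks for. *)
Lemma measurable_fun_normr_strongly Z F : strongly_measurable_in Z F ->
  measurable_fun setT (fun t => `|F t|).
Proof.
move=> [_ [s [hs sF]]].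
apply: (@measurable_fun_cvg _ _ _ _ (fun n t => `|s n t|)) => [n|t _].
  move=> _ B _; rewrite setTI.
  exact: (simple_function_preimage _ _ _ _ _ (simple_function_comp _ _ _ _
    (fun x : X => `|x|) _ (hs n).1)).
exact: cvg_norm.
Qed.

Context {mu : {sigma_finite_measure set T -> \bar R}} (E : kothe_space mu).

(** Homogeneity with scalar 0 gives the zero function norm 0, and every [f] dominates the zero
    function. *)
Lemma kothe_norm_ge0 f : kothe_car E f -> 0 <= kothe_norm E f.
Proof.
move=> Ef; have := kothe_normZ 0 Ef; rewrite scale0r normr0 mul0r => <-.
apply: (kothe_ideal (f := 0) Ef _ _).2; first exact: measurable_cst.
by apply: aeW => t /=; rewrite normr0.
Qed.

Lemma kothe_bochnerS Z W F : Z `<=` W -> kothe_bochner E Z F ->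
  kothe_bochner E W F.
Proof. by move=> ZW [mF EF]; split=> //; exact: strongly_measurable_inS mF. Qed.

Lemma kothe_bochner_comp Z W P F : norm_one_projection P -> P @` Z `<=` W ->
  kothe_bochner E Z F -> kothe_bochner E W (P \o F).
Proof.
move=> hP PZW [mF EF].
have mPF : strongly_measurable_in W (P \o F).
  by apply: strongly_measurable_in_comp mF => //;
    exact: norm_one_projection_continuous.
split=> //; apply: (kothe_ideal EF _ _).1.
  exact: measurable_fun_normr_strongly mPF.
by apply: aeW => t; rewrite !normr_id norm_one_projection_le.
Qed.

Lemma kothe_bochnerB F G : kothe_bochner E setT F -> kothe_bochner E setT G ->
  kothe_bochner E setT (F - G).
Proof.
move=> [mF EF] [mG EG].
have mB := strongly_measurable_inB F G mF mG; split=> //.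
have E_D : kothe_car E ((fun t => `|F t|) + (fun t => `|G t|)).
  have [E0 EP] := kothe_submod E.
  by have := EP 1 _ _ (mem_set EF) (mem_set EG); rewrite scale1r => /set_mem.
apply: (kothe_ideal E_D _ _).1.
  exact: measurable_fun_normr_strongly mB.
apply: aeW => t; rewrite normr_id ger0_norm ?addr_ge0//; exact: ler_normB.
Qed.

(** As [P] fixes [F], linearity gives [P \o G - F = P \o (G - F)], which is pointwise dominated by
    [G - F]. *)
Lemma kothe_bochner_norm_comp_le P F G : norm_one_projection P ->
  kothe_bochner E setT F -> kothe_bochner E setT G -> P \o F = F ->
  kothe_bochner_norm E (P \o G - F) <= kothe_bochner_norm E (G - F).
Proof.
move=> hP EF EG PF; have EB := kothe_bochnerB _ _ EG EF.
have -> : P \o G - F = P \o (G - F).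
  by rewrite -{1}PF; apply/funext => t /=; rewrite !fctE linearB.
apply: (kothe_ideal EB.2 _ _).2.
  by have [+ _] := kothe_bochner_comp _ setT _ _ hP (@subsetT _ _) EB;
    exact: measurable_fun_normr_strongly.
by apply: aeW => t; rewrite !normr_id norm_one_projection_le.
Qed.

Lemma kothe_bochner_normC F G :
  kothe_bochner_norm E (F - G) = kothe_bochner_norm E (G - F).
Proof.
by congr kothe_norm; apply/funext => t; rewrite !fctE distrC.
Qed.

End strongly_measurable.

Theorem theorem2p11 (R : realType) (d : measure_display)
    (T : measurableType d) (mu : {sigma_finite_measure set T -> \bar R})
    (E : kothe_space mu) (hE : order_continuous E)
    (X : completeNormedModType R) (Y Z1 Z2 : set X) (P : {linear X -> X})
    (hY : closed_subspace Y) (hP : norm_one_projection P) (hPY : range P = Y)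
    (hZ1 : closed_subspace Z1) (hZ2 : closed_subspace Z2)
    (hPZ1 : P @` Z1 `<=` Z1) (hZ : Z2 = Z1 `&` Y) :
  central_subspace (kothe_bochner_norm E (X := X))
    (kothe_bochner E [set: X]) (kothe_bochner E Z1) ->
  central_subspace (kothe_bochner_norm E (X := X))
    (kothe_bochner E Y) (kothe_bochner E Z2).
Proof.
move=> [[_ [Z10 Z1D] Z1cl] Z1c].
have Z2Z1 : Z2 `<=` Z1 by rewrite hZ; exact: subIsetl.
have Z2Y : Z2 `<=` Y by rewrite hZ; exact: subIsetr.
have PZ12 : P @` Z1 `<=` Z2.
  rewrite hZ => _ [z Z1z <-]; split; first by apply: hPZ1; exists z.
  by rewrite -hPY; exists z.
have fixP F : kothe_bochner E Y F -> P \o F = F.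
  move=> [[YF _] _]; apply/funext => t /=.
  by have := YF t; rewrite -hPY => -[x _ <-]; rewrite hP.1.
have PE F : kothe_bochner E Z1 F -> kothe_bochner E Z2 (P \o F).
  exact: kothe_bochner_comp.
have ET W F : kothe_bochner E W F -> kothe_bochner E [set: X] F.
  exact/kothe_bochnerS/subsetT.
split.
  split.
  - by move=> F; exact: kothe_bochnerS.
  - split.
      apply/mem_set; have := PE _ (set_mem Z10).
      by congr kothe_bochner; apply/funext => t /=; rewrite linear0.
    move=> a F G /set_mem Z2F /set_mem Z2G; apply/mem_set.
    (* Both functions are fixed by [P], so their combination is the image under [P] of a combination
       formed in [E(Z1)], where closure is given. *)
    rewrite -(fixP _ (kothe_bochnerS _ _ _ _ Z2Y Z2F)).
    rewrite -(fixP _ (kothe_bochnerS _ _ _ _ Z2Y Z2G)).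
    have -> : a *: (P \o F : T -> X) + (P \o G : T -> X) = P \o (a *: F + G).
      by apply/funext => t /=; rewrite !fctE linearP.
    apply/PE/set_mem/Z1D; apply/mem_set; exact: kothe_bochnerS Z2Z1 _.
  (* Approximants in [E(Z2)] are also approximants in [E(Z1)], whose closedness yields [G] at
     distance zero from [F]; then [P \o G] is the limit sought in [E(Z2)]. *)
  - move=> F YF apF; have [|G Z1G FG0] := Z1cl F (ET _ _ YF).
      move=> e /apF[G Z2G FG]; exists G => //; exact: kothe_bochnerS Z2Z1 _.
    exists (P \o G); first exact: PE.
    have EPG := ET _ _ (PE _ Z1G).
    apply/eqP; rewrite eq_le; apply/andP; split; last first.
      by apply: kothe_norm_ge0; exact: (kothe_bochnerB _ _ _ (ET _ _ YF) EPG).2.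
    (* Writing 0 as the distance from [F] to [G] turns the upper bound into the contraction
       estimate, up to the order of the differences. *)
    rewrite -FG0 kothe_bochner_normC [leRHS]kothe_bochner_normC.
    by apply: kothe_bochner_norm_comp_le => //; [exact: ET YF|exact: ET Z1G|exact: fixP].
(* The common point [H] of the balls lies in [E(X)] and the centres lie in [E(Z1)], so centrality
   there gives a common point [G] in [E(Z1)]. *)
move=> n F r Z2F r0 [H YH HF].
have [||G Z1G GF] := Z1c n F r _ r0.
- by move=> i; exact: kothe_bochnerS Z2Z1 _.
- by exists H => //; exact: ET YH.
exists (P \o G) => [|i]; first exact: PE.
(* Each centre [F i] has values in [Y], hence is fixed by [P], so projecting [G] does not leave the
   ball around it. *)
apply: le_trans (GF i); apply: kothe_bochner_norm_comp_le => //.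
- exact: ET (Z2F i).
- exact: ET Z1G.
- by apply: fixP; exact: kothe_bochnerS Z2Y _.
Qed.
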